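(* Let $(X,\mathcal R)$ be an upper finite preordered set with an element $w\in X$ such that $w\,\mathcal R\,x$ for all $x\in X$. Let $A$ be a commutative ring with identity, let $R=\operatorname{I}(X,A)$ be the incidence algebra of $X$ over $A$, and let $M$ be a right $A$-module. Suppose that one of the following conditions is satisfied: (1) $M$ is a cyclic $A$-module; (2) $M=AS^{-1}$, the ring of fractions of $A$ with respect to a multiplicatively closed set $S\subseteq A$. Then the rings $\operatorname{End}_A(M)$ and $\operatorname{End}_R(M(X))$ are isomorphic.
   Context: A preordered set $(X,\mathcal R)$ is upper finite if $\{y\in X\mid x\,\mathcal R\,y\}$ is finite for every $x\in X$ (so in particular every segment $\{y\mid x\,\mathcal R\,y\,\mathcal R\,z\}$ is finite). The incidence algebra $\operatorname{I}(X,A)$ is the set of all functions $f:X\times X\to A$ with $f(x,y)=0$ whenever $(x,y)\notin\mathcal R$, with operations $(f+g)(x,y)=f(x,y)+g(x,y)$, $(fg)(x,y)=\sum_{x\mathcal R z\mathcal R y}f(x,z)g(z,y)$ and $(r\cdot f)(x,y)=r f(x,y)$ for $r\in A$. For a right $A$-module $M$, $M(X)$ denotes the abelian group $M^{(X)}$ (direct sum of copies of $M$ indexed by $X$), regarded as a right $\operatorname{I}(X,A)$-module via $(m_x)_{x\in X}f=\left(\sum_{x\in X}m_xf(x,y)\right)_{y\in X}$. *)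

(* Defs.v *)
From HB Require Import structures.
From mathcomp Require Import all_boot all_order all_algebra finmap ring.
From mathcomp Require Import boolp classical_sets functions cardinality fsbigop.

Set Implicit Arguments.
Unset Strict Implicit.
Unset Printing Implicit Defensive.

Import GRing.Theory.
Import Order.PreorderTheory.

Local Open Scope classical_set_scope.
Local Open Scope quotient_scope.
Local Open Scope ring_scope.

(** MathComp only has left modules: a right module over a ring R is encoded
    throughout as a left module over the converse ring R^c. *)
Definition ract (R : pzRingType) (M : lmodType R^c) (m : M) (a : R) : M :=
  (a : R^c) *: m.

Notation "m *r a" := (ract m a)
  (at level 40, left associativity) : ring_scope.

Section RightAction.
Variables (R : pzRingType) (M : lmodType R^c).
Implicit Types (m n : M) (a b : R).

Lemma ractA m a b : m *r a *r b = m *r (a * b).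
Proof. by rewrite /ract scalerA. Qed.

Lemma ract1 m : m *r 1 = m.
Proof. exact: scale1r. Qed.

Lemma ractDl m n a : (m + n) *r a = m *r a + n *r a.
Proof. exact: scalerDr. Qed.

Lemma ractDr m a b : m *r (a + b) = m *r a + m *r b.
Proof. exact: scalerDl. Qed.

Lemma ract0l a : (0 : M) *r a = 0.
Proof. exact: scaler0. Qed.

Lemma ract0r m : m *r 0 = 0.
Proof. exact: scale0r. Qed.

Lemma ract_suml (I : Type) (s : seq I) (F : I -> M) a :
  (\sum_(i <- s) F i) *r a = \sum_(i <- s) F i *r a.
Proof. exact: scaler_sumr. Qed.

Lemma ract_sumr (I : Type) (s : seq I) (F : I -> R) m :
  m *r (\sum_(i <- s) F i) = \sum_(i <- s) m *r F i.
Proof. exact: scaler_suml. Qed.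

End RightAction.

Definition cyclic_rmodule (R : pzRingType) (M : lmodType R^c) : Prop :=
  exists g : M, forall m : M, exists a : R, m = g *r a.

Section EndomorphismRing.
Variables (R : pzRingType) (M : lmodType R).

Definition endo : Type := {linear M -> M}.

HB.instance Definition _ := gen_eqMixin endo.
HB.instance Definition _ := gen_choiceMixin endo.

Lemma endo_eq (f g : endo) :
  (f : {linear M -> M}) =1 (g : {linear M -> M}) -> f = g.
Proof.
case: f g => [f [[f1] [f2]]] [g [[g1] [g2]]] /= /funext fg.
by subst g; rewrite (Prop_irrelevance f1 g1) (Prop_irrelevance f2 g2).
Qed.

Definition endo_zero : endo := \0.
Definition endo_opp (f : endo) : endo := \- (f : {linear M -> M}).
Definition endo_add (f g : endo) : endo :=
  (f : {linear M -> M}) \+ (g : {linear M -> M}).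
Definition endo_one : endo := idfun.
Definition endo_mul (f g : endo) : endo :=
  (f : {linear M -> M}) \o (g : {linear M -> M}).

Fact endo_addA : associative endo_add.
Proof. by move=> f g h; apply: endo_eq => m /=; rewrite addrA. Qed.
Fact endo_addC : commutative endo_add.
Proof. by move=> f g; apply: endo_eq => m /=; rewrite addrC. Qed.
Fact endo_add0 : left_id endo_zero endo_add.
Proof. by move=> f; apply: endo_eq => m /=; rewrite add0r. Qed.
Fact endo_addN : left_inverse endo_zero endo_opp endo_add.
Proof. by move=> f; apply: endo_eq => m /=; rewrite addNr. Qed.

HB.instance Definition _ :=
  GRing.isZmodule.Build endo endo_addA endo_addC endo_add0 endo_addN.

Fact endo_mulA : associative endo_mul.
Proof. by move=> f g h; apply: endo_eq. Qed.
Fact endo_mul1l : left_id endo_one endo_mul.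
Proof. by move=> f; apply: endo_eq. Qed.
Fact endo_mul1r : right_id endo_one endo_mul.
Proof. by move=> f; apply: endo_eq. Qed.
Fact endo_mulDl : left_distributive endo_mul +%R.
Proof. by move=> f g h; apply: endo_eq. Qed.
Fact endo_mulDr : right_distributive endo_mul +%R.
Proof. by move=> f g h; apply: endo_eq => m /=; rewrite raddfD. Qed.

HB.instance Definition _ := GRing.Zmodule_isPzRing.Build endo
  endo_mulA endo_mul1l endo_mul1r endo_mulDl endo_mulDr.

End EndomorphismRing.

(** For a right R-module M, the type of M is lmodType R^c, and [endo M] is
    End_R(M), with (f * g) m = f (g m). *)
Arguments endo {R} M.

Definition upper_finite (d : Order.disp_t) (X : preorderType d) : Prop :=
  forall x : X, finite_set [set y : X | (x <= y)%O].

Section IncidenceAlgebra.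
Variables (d : Order.disp_t) (X : preorderType d) (A : comPzRingType).

(** The proof of upper finiteness is a parameter of the type because the
    ring axioms below depend on it. *)
Record incidence (hX : upper_finite X) := Incidence {
  incidence_fun :> X -> X -> A;
  incidence_out : forall x y, ~~ (x <= y)%O -> incidence_fun x y = 0
}.

Variable hX : upper_finite X.
Local Notation I := (incidence hX).
Implicit Types f g h : I.

HB.instance Definition _ := gen_eqMixin I.
HB.instance Definition _ := gen_choiceMixin I.

Lemma incidence_eq f g : (forall x y, f x y = g x y) -> f = g.
Proof.
case: f g => [f f0] [g g0] /= fg.
have {}fg : f = g by apply/funext => x; apply/funext => y.
by subst g; rewrite (Prop_irrelevance f0 g0).
Qed.

Definition inc_zero : I := @Incidence hX (fun _ _ => 0) (fun _ _ _ => erefl).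

Fact inc_opp_subproof f x y : ~~ (x <= y)%O -> - f x y = 0.
Proof. by move=> xy; rewrite incidence_out// oppr0. Qed.
Definition inc_opp f : I := Incidence hX (inc_opp_subproof f).

Fact inc_add_subproof f g x y : ~~ (x <= y)%O -> f x y + g x y = 0.
Proof. by move=> xy; rewrite !incidence_out// addr0. Qed.
Definition inc_add f g : I := Incidence hX (inc_add_subproof f g).

Fact inc_one_subproof (x y : X) : ~~ (x <= y)%O -> (x == y)%:R = 0 :> A.
Proof. by case: eqP => // ->; rewrite lexx. Qed.
Definition inc_one : I := Incidence hX inc_one_subproof.

Fact inc_mul_subproof f g x y : ~~ (x <= y)%O ->
  \sum_(z \in [set z : X | (x <= z <= y)%O]) f x z * g z y = 0.
Proof.
move=> xy; rewrite fsbig1// => z /= /andP[xz zy].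
by rewrite (le_trans xz zy) in xy.
Qed.
Definition inc_mul f g : I := Incidence hX (inc_mul_subproof f g).

Fact inc_scale_subproof (r : A) f x y : ~~ (x <= y)%O -> r * f x y = 0.
Proof. by move=> xy; rewrite incidence_out// mulr0. Qed.
Definition inc_scale (r : A) f : I := Incidence hX (inc_scale_subproof r f).

Lemma inc_mulE (B : {fset X}) f g x y :
    (forall z, (x <= z <= y)%O -> z \in B) ->
  inc_mul f g x y = \sum_(z <- B) f x z * g z y.
Proof.
move=> xyB /=.
have out z : ~~ (x <= z <= y)%O -> f x z * g z y = 0.
  rewrite negb_and => /orP[xz|zy].
    by rewrite (incidence_out _ xz) mul0r.
  by rewrite (incidence_out _ zy) mulr0.
rewrite (fsbig_fwiden B)//= => z [_] /= /negP; exact: out.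
Qed.

Definition up_fset (x : X) : {fset X} := fset_set [set y | (x <= y)%O].

Lemma in_up_fset x y : (y \in up_fset x) = (x <= y)%O.
Proof. by rewrite in_fset_set//; apply/idP/idP; rewrite inE. Qed.

Lemma inc_mulE_up f g x y :
  inc_mul f g x y = \sum_(z <- up_fset x) f x z * g z y.
Proof. by apply: inc_mulE => z /andP[xz _]; rewrite in_up_fset. Qed.

Fact inc_addA : associative inc_add.
Proof. by move=> f g h; apply: incidence_eq => x y /=; rewrite addrA. Qed.
Fact inc_addC : commutative inc_add.
Proof. by move=> f g; apply: incidence_eq => x y /=; rewrite addrC. Qed.
Fact inc_add0 : left_id inc_zero inc_add.
Proof. by move=> f; apply: incidence_eq => x y /=; rewrite add0r. Qed.
Fact inc_addN : left_inverse inc_zero inc_opp inc_add.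
Proof. by move=> f; apply: incidence_eq => x y /=; rewrite addNr. Qed.

HB.instance Definition _ :=
  GRing.isZmodule.Build I inc_addA inc_addC inc_add0 inc_addN.

Lemma inc_addE f g x y : (f + g) x y = f x y + g x y.
Proof. by []. Qed.

Fact inc_mulA : associative inc_mul.
Proof.
move=> f g h; apply: incidence_eq => x y; rewrite !inc_mulE_up.
transitivity (\sum_(z <- up_fset x) \sum_(t <- up_fset x)
    f x z * g z t * h t y).
  rewrite !big_seq; apply: eq_bigr => z; rewrite in_up_fset => xz.
  rewrite (@inc_mulE (up_fset x)); last first.
    by move=> t /andP[zt _]; rewrite in_up_fset (le_trans xz zt).
  by rewrite mulr_sumr; apply: eq_bigr => t _; rewrite mulrA.
rewrite exchange_big; apply: eq_bigr => t _.
by rewrite inc_mulE_up mulr_suml.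
Qed.

Fact inc_mul1l : left_id inc_one inc_mul.
Proof.
move=> f; apply: incidence_eq => x y; rewrite inc_mulE_up.
rewrite (big_fsetD1 x)/= ?in_up_fset// eqxx mul1r big_seq big1 ?addr0// => z.
by rewrite !inE eq_sym => /andP[/negbTE-> _]; rewrite mul0r.
Qed.

Fact inc_mul1r : right_id inc_one inc_mul.
Proof.
move=> f; apply: incidence_eq => x y.
rewrite (@inc_mulE (y |` up_fset x)%fset); last first.
  by move=> z /andP[xz _]; rewrite !inE in_up_fset xz orbT.
rewrite (big_fsetD1 y)/= ?fset1U1// eqxx mulr1 big_seq big1 ?addr0// => z.
by rewrite !inE => /andP[/negbTE-> _]; rewrite mulr0.
Qed.

Fact inc_mulDl : left_distributive inc_mul +%R.
Proof.
move=> f g h; apply: incidence_eq => x y; rewrite inc_addE !inc_mulE_up.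
by rewrite -big_split; apply: eq_bigr => z _; rewrite mulrDl.
Qed.

Fact inc_mulDr : right_distributive inc_mul +%R.
Proof.
move=> f g h; apply: incidence_eq => x y; rewrite inc_addE !inc_mulE_up.
by rewrite -big_split; apply: eq_bigr => z _; rewrite mulrDr.
Qed.

HB.instance Definition _ := GRing.Zmodule_isPzRing.Build I
  inc_mulA inc_mul1l inc_mul1r inc_mulDl inc_mulDr.

Fact inc_scaleA (a b : A) f : inc_scale a (inc_scale b f) = inc_scale (a * b) f.
Proof. by apply: incidence_eq => x y /=; rewrite mulrA. Qed.
Fact inc_scale1 : left_id 1 inc_scale.
Proof. by move=> f; apply: incidence_eq => x y /=; rewrite mul1r. Qed.
Fact inc_scaleDr : right_distributive inc_scale +%R.
Proof. by move=> a f g; apply: incidence_eq => x y /=; rewrite mulrDr. Qed.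
Fact inc_scaleDl f : {morph inc_scale^~ f : a b / a + b}.
Proof. by move=> a b; apply: incidence_eq => x y /=; rewrite mulrDl. Qed.

HB.instance Definition _ := GRing.Zmodule_isLmodule.Build A I
  inc_scaleA inc_scale1 inc_scaleDr inc_scaleDl.

Lemma inc_scaleE (a : A) f x y : (a *: f) x y = a * f x y.
Proof. by []. Qed.

Lemma inc_scaleAl (a : A) f g : a *: (f * g) = a *: f * g.
Proof.
apply: incidence_eq => x y; rewrite inc_scaleE !inc_mulE_up mulr_sumr.
by apply: eq_bigr => z _; rewrite mulrA.
Qed.

Lemma inc_scaleAr (a : A) f g : a *: (f * g) = f * (a *: g).
Proof.
apply: incidence_eq => x y; rewrite inc_scaleE !inc_mulE_up mulr_sumr.
by apply: eq_bigr => z _; rewrite /= mulrCA.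
Qed.

End IncidenceAlgebra.

Arguments incidence {d X} A hX.

(** M(X), the finitely supported families; [hX] is recorded in the type only
    for the sake of the action of the incidence algebra. *)
Record dsum (d : Order.disp_t) (X : preorderType d) (hX : upper_finite X)
    (A : comPzRingType) (M : lmodType A^c) := DSum {
  dsum_fun :> X -> M;
  dsum_fin : finite_set [set x | dsum_fun x <> 0]
}.

Section DirectSum.
Variables (d : Order.disp_t) (X : preorderType d) (hX : upper_finite X).
Variables (A : comPzRingType) (M : lmodType A^c).

Local Notation MX := (dsum hX M).
Implicit Types (m n : MX) (f g : incidence A hX).

HB.instance Definition _ := gen_eqMixin MX.
HB.instance Definition _ := gen_choiceMixin MX.

Lemma dsum_eq m n : (forall x, m x = n x) -> m = n.
Proof.
case: m n => [m m0] [n n0] /= /funext mn.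
by subst n; rewrite (Prop_irrelevance m0 n0).
Qed.

Fact dsum_zero_subproof : finite_set [set x : X | (0 : M) <> 0].
Proof. by apply: (sub_finite_set _ (finite_set0 X)) => x /=. Qed.
Definition dsum_zero : MX := @DSum d X hX A M (fun=> 0) dsum_zero_subproof.

Fact dsum_opp_subproof m : finite_set [set x | - m x <> 0].
Proof.
apply: (sub_finite_set _ (dsum_fin m)) => x /= mx0 mx.
by apply: mx0; rewrite mx oppr0.
Qed.
Definition dsum_opp m : MX := DSum hX (dsum_opp_subproof m).

Fact dsum_add_subproof m n : finite_set [set x | m x + n x <> 0].
Proof.
suff: [set x | m x + n x <> 0] `<=` [set x | m x <> 0] `|` [set x | n x <> 0].
  by move/sub_finite_set; apply; rewrite finite_setU; split; exact: dsum_fin.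
move=> x /= mnx; have [mx|/eqP mx] := eqVneq (m x) 0; [right|by left].
by move=> nx; apply: mnx; rewrite mx nx addr0.
Qed.
Definition dsum_add m n : MX := DSum hX (dsum_add_subproof m n).

Definition supp_fset m : {fset X} := fset_set [set x | m x <> 0].

Lemma supp_fsetPn m x : x \notin supp_fset m -> m x = 0.
Proof.
rewrite in_fset_set ?notin_setE; last exact: dsum_fin.
by move=> /= /contrapT.
Qed.

Definition up_supp m : {fset X} :=
  (\bigcup_(x <- supp_fset m) up_fset x)%fset.

Lemma up_suppPn m x y : (x <= y)%O -> y \notin up_supp m -> m x = 0.
Proof.
move=> xy; apply: contraNeq => mx0; apply/bigfcupP; exists x.
  by rewrite andbT; apply: contraNT mx0 => /supp_fsetPn->.
by rewrite (in_up_fset hX).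
Qed.

Lemma dsum_actE (B : {fset X}) m f y :
    (forall x, x \notin B -> m x = 0) ->
  \sum_(x \in [set: X]) m x *r f x y = \sum_(x <- B) m x *r f x y.
Proof. by move=> mB; apply: fsbigTE => x /mB ->; rewrite ract0l. Qed.

Fact dsum_act_subproof m f :
  finite_set [set y | \sum_(x \in [set: X]) m x *r f x y <> 0].
Proof.
apply: (finite_subfset (up_supp m)) => y /=.
apply: contra_notT => ym; apply: fsbig1 => x _.
have [xy|xy] := boolP (x <= y)%O; first by rewrite (up_suppPn xy ym) ract0l.
by rewrite incidence_out// ract0r.
Qed.
Definition dsum_act m f : MX := DSum hX (dsum_act_subproof m f).

Fact dsum_addA : associative dsum_add.
Proof. by move=> m n p; apply: dsum_eq => x /=; rewrite addrA. Qed.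
Fact dsum_addC : commutative dsum_add.
Proof. by move=> m n; apply: dsum_eq => x /=; rewrite addrC. Qed.
Fact dsum_add0 : left_id dsum_zero dsum_add.
Proof. by move=> m; apply: dsum_eq => x /=; rewrite add0r. Qed.
Fact dsum_addN : left_inverse dsum_zero dsum_opp dsum_add.
Proof. by move=> m; apply: dsum_eq => x /=; rewrite addNr. Qed.

HB.instance Definition _ :=
  GRing.isZmodule.Build MX dsum_addA dsum_addC dsum_add0 dsum_addN.

Definition dsum_scale (f : (incidence A hX)^c) m : MX := dsum_act m f.

Lemma up_supp_out m x : x \notin up_supp m -> m x = 0.
Proof. by apply: up_suppPn. Qed.

Lemma dsum_act_out m f y : y \notin up_supp m -> dsum_act m f y = 0.
Proof.
move=> ym; rewrite /= (dsum_actE _ _ (@up_supp_out m)) big1// => x _.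
have [xy|xy] := boolP (x <= y)%O; first by rewrite (up_suppPn xy ym) ract0l.
by rewrite incidence_out// ract0r.
Qed.

Fact dsum_scaleA (f g : (incidence A hX)^c) m :
  dsum_scale f (dsum_scale g m) = dsum_scale (f * g) m.
Proof.
apply: dsum_eq => y; rewrite /dsum_scale.
have Bout := @up_supp_out m.
rewrite [LHS](@dsum_actE (up_supp m)); last exact: dsum_act_out.
rewrite [RHS](dsum_actE _ _ Bout).
under eq_bigr do rewrite /= (dsum_actE _ _ Bout) ract_suml.
rewrite exchange_big [LHS]big_seq [RHS]big_seq /=; apply: eq_bigr => x xB.
transitivity (m x *r inc_mul g f x y); last by [].
rewrite (@inc_mulE _ _ _ _ (up_supp m)); last first.
  move=> z /andP[xz _]; have /bigfcupP[t tm tx] := xB.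
  apply/bigfcupP; exists t => //; move: tx; rewrite !(in_up_fset hX) => tx.
  exact: le_trans tx xz.
by rewrite ract_sumr; apply: eq_bigr => z _; rewrite ractA.
Qed.

Fact dsum_scale1 : left_id 1 dsum_scale.
Proof.
move=> m; apply: dsum_eq => y.
rewrite [LHS](@dsum_actE (y |` supp_fset m)%fset); last first.
  by move=> x; rewrite !inE negb_or => /andP[_]; exact: supp_fsetPn.
rewrite (big_fsetD1 y)/= ?fset1U1// eqxx ract1 big_seq big1 ?addr0// => z.
by rewrite !inE => /andP[/negbTE-> _]; rewrite ract0r.
Qed.

Fact dsum_scaleDr : right_distributive dsum_scale +%R.
Proof.
move=> f m n; apply: dsum_eq => y.
pose B := (supp_fset m `|` supp_fset n)%fset.
have mB x : x \notin B -> m x = 0.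
  by rewrite inE negb_or => /andP[/supp_fsetPn].
have nB x : x \notin B -> n x = 0.
  by rewrite inE negb_or => /andP[_ /supp_fsetPn].
rewrite [LHS](@dsum_actE B); last first.
  by move=> x xB /=; rewrite mB// nB// addr0.
rewrite [RHS]/= (dsum_actE _ _ mB) (dsum_actE _ _ nB).
by rewrite -big_split; apply: eq_bigr => x _; rewrite ractDl.
Qed.

Fact dsum_scaleDl m : {morph dsum_scale^~ m : f g / f + g}.
Proof.
move=> f g; apply: dsum_eq => y; rewrite [LHS](dsum_actE _ _ (@supp_fsetPn m)).
rewrite [RHS]/= !(dsum_actE _ _ (@supp_fsetPn m)).
by rewrite -big_split; apply: eq_bigr => x _; rewrite ractDr.
Qed.

HB.instance Definition _ := GRing.Zmodule_isLmodule.Build (incidence A hX)^c MX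
  dsum_scaleA dsum_scale1 dsum_scaleDr dsum_scaleDl.

End DirectSum.

Section Fractions.
Variables (A : comPzRingType) (S : mulrClosed A).

(** S may contain zero divisors, so MathComp's [fraction] does not apply:
    a/s = b/t iff u(at - bs) = 0 for some u in S. Multiplicatively closed
    includes 1 \in S. *)
Local Notation pre := (A * {s : A | s \in S})%type.
Implicit Types p q r : pre.

Definition frac_rel : rel pre := fun p q =>
  `[< exists2 u, u \in S & u * (p.1 * val q.2) = u * (q.1 * val p.2) >].

Fact frac_rel_equiv : equiv_class_of frac_rel.
Proof.
split=> [p|p q|q p r].
- by apply/asboolP; exists 1; rewrite ?rpred1.
- by apply/asboolP/asboolP => -[u Su e]; exists u.
move=> /asboolP[u Su pq] /asboolP[v Sv qr]; apply/asboolP.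
exists (u * v * val q.2); first by rewrite !rpredM// (valP q.2).
transitivity (v * val r.2 * (u * (p.1 * val q.2))); first by ring.
rewrite pq; transitivity (u * val p.2 * (v * (q.1 * val r.2))); first by ring.
by rewrite qr; ring.
Qed.

Canonical frac_equiv := EquivRelPack frac_rel_equiv.

Definition fractions := {eq_quot frac_rel}.

HB.instance Definition _ := Choice.on fractions.

Definition mkfrac p : fractions := \pi_({eq_quot frac_rel}) p.

Lemma mkfracP p q :
  mkfrac p = mkfrac q <->
  exists2 u, u \in S & u * (p.1 * val q.2) = u * (q.1 * val p.2).
Proof.
split=> [/eqmodP /asboolP //|pq]; apply/eqmodP; exact/asboolP.
Qed.

Lemma mkfracW (P : fractions -> Prop) : (forall p, P (mkfrac p)) -> forall x, P x.
Proof. by move=> PP; elim/quotW. Qed.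

Fact den1_subproof : 1 \in S. Proof. exact: rpred1. Qed.
Fact denM_subproof (s t : {s : A | s \in S}) : val s * val t \in S.
Proof. by rewrite rpredM ?(valP s) ?(valP t). Qed.
Definition den1 : {s : A | s \in S} := exist _ 1 den1_subproof.
Definition denM (s t : {s : A | s \in S}) : {s : A | s \in S} :=
  exist _ (val s * val t) (denM_subproof s t).

Definition frac_rep (x : fractions) : pre := repr (x : {eq_quot frac_rel}).

Lemma frac_repK x : mkfrac (frac_rep x) = x.
Proof. exact: reprK. Qed.

Definition pre_opp p : pre := (- p.1, p.2).
Definition pre_add p q : pre :=
  (p.1 * val q.2 + q.1 * val p.2, denM p.2 q.2).
Definition pre_mul p q : pre := (p.1 * q.1, denM p.2 q.2).

Definition frac_zero : fractions := mkfrac (0, den1).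
Definition frac_one : fractions := mkfrac (1, den1).
Definition frac_opp (x : fractions) : fractions := mkfrac (pre_opp (frac_rep x)).
Definition frac_add (x y : fractions) : fractions :=
  mkfrac (pre_add (frac_rep x) (frac_rep y)).
Definition frac_mul (x y : fractions) : fractions :=
  mkfrac (pre_mul (frac_rep x) (frac_rep y)).

Lemma frac_oppE p : frac_opp (mkfrac p) = mkfrac (pre_opp p).
Proof.
have /mkfracP[u Su e] := frac_repK (mkfrac p).
apply/mkfracP; exists u => //=; rewrite !mulNr !mulrN.
by rewrite e.
Qed.

Lemma frac_addE p q :
  frac_add (mkfrac p) (mkfrac q) = mkfrac (pre_add p q).
Proof.
have /mkfracP[u Su ep] := frac_repK (mkfrac p).
have /mkfracP[v Sv eqq] := frac_repK (mkfrac q).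
apply/mkfracP; exists (u * v); first exact: rpredM.
move: (frac_rep (mkfrac p)) (frac_rep (mkfrac q)) ep eqq => p' q' ep eqq /=.
transitivity (v * val q'.2 * val q.2 * (u * (p'.1 * val p.2))
            + u * val p'.2 * val p.2 * (v * (q'.1 * val q.2))); first by rewrite /=; ring.
by rewrite ep eqq /=; ring.
Qed.

Lemma frac_mulE p q :
  frac_mul (mkfrac p) (mkfrac q) = mkfrac (pre_mul p q).
Proof.
have /mkfracP[u Su ep] := frac_repK (mkfrac p).
have /mkfracP[v Sv eqq] := frac_repK (mkfrac q).
apply/mkfracP; exists (u * v); first exact: rpredM.
move: (frac_rep (mkfrac p)) (frac_rep (mkfrac q)) ep eqq => p' q' ep eqq /=.
transitivity (u * (p'.1 * val p.2) * (v * (q'.1 * val q.2))); first by rewrite /=; ring.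
by rewrite ep eqq /=; ring.
Qed.

Let mkfrac_eq p q : p.1 * val q.2 = q.1 * val p.2 -> mkfrac p = mkfrac q.
Proof. by move=> e; apply/mkfracP; exists 1; rewrite ?rpred1 ?e. Qed.

Fact frac_addA : associative frac_add.
Proof.
elim/mkfracW => p; elim/mkfracW => q; elim/mkfracW => r.
by rewrite !frac_addE; apply: mkfrac_eq; rewrite /den1/=; ring.
Qed.
Fact frac_addC : commutative frac_add.
Proof.
elim/mkfracW => p; elim/mkfracW => q.
by rewrite !frac_addE; apply: mkfrac_eq; rewrite /den1/=; ring.
Qed.
Fact frac_add0 : left_id frac_zero frac_add.
Proof. by elim/mkfracW => p; rewrite frac_addE; apply: mkfrac_eq; rewrite /den1/=; ring. Qed.
Fact frac_addN : left_inverse frac_zero frac_opp frac_add.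
Proof.
elim/mkfracW => p.
by rewrite frac_oppE frac_addE; apply: mkfrac_eq; rewrite /den1/=; ring.
Qed.

HB.instance Definition _ :=
  GRing.isZmodule.Build fractions frac_addA frac_addC frac_add0 frac_addN.

Fact frac_mulA : associative frac_mul.
Proof.
elim/mkfracW => p; elim/mkfracW => q; elim/mkfracW => r.
by rewrite !frac_mulE; apply: mkfrac_eq; rewrite /den1/=; ring.
Qed.
Fact frac_mulC : commutative frac_mul.
Proof.
elim/mkfracW => p; elim/mkfracW => q.
by rewrite !frac_mulE; apply: mkfrac_eq; rewrite /den1/=; ring.
Qed.
Fact frac_mul1 : left_id frac_one frac_mul.
Proof. by elim/mkfracW => p; rewrite frac_mulE; apply: mkfrac_eq; rewrite /den1/=; ring. Qed.
Fact frac_mulDl : left_distributive frac_mul +%R.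
Proof.
elim/mkfracW => p; elim/mkfracW => q; elim/mkfracW => r.
have -> : mkfrac p + mkfrac q = mkfrac (pre_add p q) by exact: frac_addE.
rewrite !frac_mulE; transitivity (mkfrac (pre_add (pre_mul p r) (pre_mul q r))).
  by apply: mkfrac_eq; rewrite /=; ring.
by rewrite -frac_addE.
Qed.

HB.instance Definition _ := GRing.Zmodule_isComPzRing.Build fractions
  frac_mulA frac_mulC frac_mul1 frac_mulDl.

Definition to_frac (a : A) : fractions := mkfrac (a, den1).

Fact to_frac_is_zmod_morphism : zmod_morphism to_frac.
Proof.
move=> a b; have -> : - to_frac b = mkfrac (pre_opp (b, den1)).
  exact: frac_oppE.
apply: etrans (esym (frac_addE _ _)).
by apply: mkfrac_eq; rewrite /den1/=; ring.
Qed.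
Fact to_frac_is_monoid_morphism : monoid_morphism to_frac.
Proof.
split=> // a b; apply: etrans (esym (frac_mulE _ _)).
by apply: mkfrac_eq; rewrite /den1/=; ring.
Qed.

HB.instance Definition _ := GRing.isZmodMorphism.Build A fractions to_frac
  to_frac_is_zmod_morphism.
HB.instance Definition _ := GRing.isMonoidMorphism.Build A fractions to_frac
  to_frac_is_monoid_morphism.

Definition frac_scale (a : A^c) (x : fractions) : fractions :=
  x * to_frac (a : A).

Fact frac_scaleA (a b : A^c) x :
  frac_scale a (frac_scale b x) = frac_scale (a * b) x.
Proof. by rewrite /frac_scale -mulrA -rmorphM. Qed.
Fact frac_scale1 : left_id 1 frac_scale.
Proof. by move=> x; rewrite /frac_scale rmorph1 mulr1. Qed.
Fact frac_scaleDr : right_distributive frac_scale +%R.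
Proof. by move=> a x y; rewrite /frac_scale mulrDl. Qed.
Fact frac_scaleDl x : {morph frac_scale^~ x : a b / a + b}.
Proof. by move=> a b; rewrite /frac_scale rmorphD mulrDr. Qed.

HB.instance Definition _ := GRing.Zmodule_isLmodule.Build A^c fractions
  frac_scaleA frac_scale1 frac_scaleDr frac_scaleDl.

End Fractions.

(* Main.v *)
Require Import Defs.
From HB Require Import structures.
From mathcomp Require Import all_boot all_order all_algebra.
From mathcomp Require Import finmap classical_sets cardinality fsbigop.

Set Implicit Arguments.
Unset Strict Implicit.
Unset Printing Implicit Defensive.

Import GRing.Theory Order.PreorderTheory.

Local Open Scope ring_scope.

(** An A-endomorphism of M acts on M(X) coordinatewise, and this action commutes
    with the incidence algebra. Conversely, let F be an endomorphism of M(X) and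
    e_xy the matrix unit of a pair x <= y. Since F commutes with e_yy and e_wy,
      (F m)_y = F(m e_yy)_y = F((m_y at w) e_wy)_y = F(m_y at w)_w,
    so F is the coordinatewise action of n |-> F(n at w)_w. *)

Section MatrixUnits.
Variables (d : Order.disp_t) (X : preorderType d) (hX : upper_finite X).
Variables (A : comPzRingType) (M : lmodType A^c).

Fact inc_unit_subproof (x y : X) (a : A) u v : ~~ (u <= v)%O ->
  (if [&& (x <= y)%O, u == x & v == y] then a else 0) = 0.
Proof. by case: and3P => // -[xy /eqP-> /eqP->]; rewrite xy. Qed.

(* This is a *: e_xy if x <= y, and 0 otherwise. *)
Definition inc_unit (x y : X) (a : A) : incidence A hX :=
  Incidence hX (@inc_unit_subproof x y a).

Fact dsum_single_subproof (x : X) (n : M) :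
  finite_set [set y | (if y == x then n else 0) <> 0]%classic.
Proof.
apply: (sub_finite_set _ (finite_set1 x)) => y /=.
by case: eqP.
Qed.

Definition dsum_single (x : X) (n : M) : dsum hX M :=
  DSum hX (@dsum_single_subproof x n).

(** Row [x] is the only nonzero row of the unit, so one summand survives and it lands in column
    [y]. *)
Lemma dsum_act_unit (m : dsum hX M) x y a : (x <= y)%O ->
  m *r inc_unit x y a = dsum_single y (m x *r a).
Proof.
move=> xy; apply: dsum_eq => v.
transitivity (\sum_(u \in [set: X]%classic) m u *r inc_unit x y a u v) => //.
rewrite (fsbigTE [fset x]%fset).
  by rewrite big_seq_fset1 /= xy eqxx; case: eqP => // _; rewrite ract0r.
by move=> u; rewrite inE => /negbTE ux; rewrite /= ux andbF ract0r.
Qed.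

Lemma dsum_single_add x : {morph dsum_single x : m n / m + n}.
Proof.
move=> m n; apply: dsum_eq => y.
by rewrite /=; case: eqP => //; rewrite addr0.
Qed.

Lemma dsum_singleE x n : dsum_single x n x = n.
Proof. by rewrite /= eqxx. Qed.

End MatrixUnits.

Section DiagonalEndomorphisms.
Variables (d : Order.disp_t) (X : preorderType d) (hX : upper_finite X).
Variables (A : comPzRingType) (M : lmodType A^c).
Local Notation MX := (dsum hX M : lmodType (incidence A hX)^c).

Section Diagonal.
Variable f : endo M.

Fact dsum_map_subproof (m : dsum hX M) :
  finite_set [set x | (f : {linear M -> M}) (m x) <> 0]%classic.
Proof.
apply: (sub_finite_set _ (dsum_fin m)) => x /= fmx mx.
by apply: fmx; rewrite mx linear0.
Qed.

Definition dsum_map (m : dsum hX M) : dsum hX M :=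
  DSum hX (@dsum_map_subproof m).

Fact dsum_map_linear : linear (dsum_map : MX -> MX).
Proof.
move=> r m n; apply: dsum_eq => y.
have mE := dsum_actE r y (@supp_fsetPn _ _ hX _ _ m).
(* As [f] sends 0 to 0, applying it creates no new support. Both sums thus run over the finite
   support of [m], where [f] can be moved inside. *)
have fmE : \sum_(x \in [set: X]%classic) dsum_map m x *r (r : incidence A hX) x y =
    \sum_(x <- supp_fset m) dsum_map m x *r (r : incidence A hX) x y.
  by apply: dsum_actE => x /supp_fsetPn /= ->; rewrite linear0.
transitivity ((f : {linear M -> M})
    (\sum_(x \in [set: X]%classic) m x *r (r : incidence A hX) x y + n y)) => //.
rewrite mE linearD linear_sum.
transitivity (\sum_(x \in [set: X]%classic) dsum_map m x *r (r : incidence A hX) x y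
   + (f : {linear M -> M}) (n y)) => //.
rewrite fmE; congr (_ + _); apply: eq_bigr => x _.
by rewrite /ract linearZ.
Qed.

HB.instance Definition _ := GRing.isLinear.Build _ MX MX _ dsum_map dsum_map_linear.

Definition diag_endo : endo MX := dsum_map : {linear MX -> MX}.

End Diagonal.

Fact diag_endo_zmod_morphism : zmod_morphism diag_endo.
Proof. by move=> f g; apply: endo_eq => m; apply: dsum_eq. Qed.

Fact diag_endo_monoid_morphism : monoid_morphism diag_endo.
Proof.
by split=> [|f g]; apply: endo_eq => m; apply: dsum_eq.
Qed.

HB.instance Definition _ := GRing.isZmodMorphism.Build _ _ diag_endo
  diag_endo_zmod_morphism.
HB.instance Definition _ := GRing.isMonoidMorphism.Build _ _ diag_endo
  diag_endo_monoid_morphism.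

Section Corner.
Variables (w : X) (F : endo MX).

Definition corner_fun (n : M) : M :=
  ((F : {linear MX -> MX}) (dsum_single hX w n)) w.

Lemma endo_act (m : MX) (r : incidence A hX) :
  (F : {linear MX -> MX}) (m *r r) = (F : {linear MX -> MX}) m *r r.
Proof. exact: linearZ. Qed.

(** The scalar [a] is simulated on coordinate [w] by the ring element [a * e_ww], with which [F]
    commutes. *)
Fact corner_linear : linear corner_fun.
Proof.
move=> a m n; rewrite /corner_fun dsum_single_add linearD.
have -> : dsum_single hX w (a *: m) = dsum_single hX w m *r inc_unit hX w w (a : A).
  by rewrite dsum_act_unit// dsum_singleE.
rewrite endo_act dsum_act_unit//.
exact: (congr1 (fun u => u + _) (dsum_singleE _ _ _)).
Qed.

HB.instance Definition _ := GRing.isLinear.Build _ M M _ corner_fun corner_linear.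

Definition corner : endo M := corner_fun : {linear M -> M}.

(** Minimality of [w] provides a matrix unit [e_wy] for every [y], so the behaviour of [F] at [w]
    determines it on every coordinate. *)
Lemma corner_diag (hw : forall x : X, (w <= x)%O) : diag_endo corner = F.
Proof.
apply: endo_eq => m; apply: dsum_eq => y.
transitivity (corner_fun (m y)) => //; rewrite /corner_fun.
set n := dsum_single hX w (m y).
(* Acting by [e_wy] copies coordinate [w] of [F n] to coordinate [y]. *)
transitivity (((F : {linear MX -> MX}) n *r inc_unit hX w y 1) y).
  by rewrite dsum_act_unit// dsum_singleE ract1.
rewrite -endo_act dsum_act_unit// dsum_singleE.
(* The transported vector is the [y]-component of [m], that is [m e_yy]; pulling [e_yy] out of [F]
   leaves coordinate [y] of [F m]. *)
have -> : dsum_single hX y (m y *r 1) = (m : MX) *r inc_unit hX y y 1.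
  by rewrite dsum_act_unit.
by rewrite endo_act dsum_act_unit// dsum_singleE ract1.
Qed.

End Corner.

(** Coordinate [w] of the family with [n] at [w] is [n] itself, so the corner of a diagonal action
    returns [f n]. *)
Lemma diagK (w : X) : cancel diag_endo (corner w).
Proof. by move=> f; apply: endo_eq => n; rewrite /= /corner_fun /= eqxx. Qed.

End DiagonalEndomorphisms.

Theorem proposition1p10 (d : Order.disp_t) (X : preorderType d)
    (hX : upper_finite X) (w : X) (hw : forall x : X, (w <= x)%O)
    (A : comPzRingType) (M : lmodType A^c)
    (hM : cyclic_rmodule M \/
          exists (S : mulrClosed A) (i : {linear fractions S -> M}),
            bijective i) :
  exists phi : {rmorphism endo M -> endo (dsum hX M : lmodType (incidence A hX)^c)},
    bijective phi.
Proof.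
exists (@diag_endo d X hX A M); exists (@corner d X hX A M w).
- exact: diagK.
- by move=> F; exact: corner_diag.
Qed.
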